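(* Let $X$ be a Suslinian chainable continuum, and let $E\subset X$ be a non-empty totally disconnected $G_\delta$-subset of $X$. Then there exists a point $e\in E$ such that the space $E$ (with the subspace topology) is zero-dimensional at $e$.
   Context: A continuum is a compact connected metric space. A continuum $X$ is Suslinian if there is no uncountable collection of pairwise disjoint non-degenerate subcontinua of $X$ (non-degenerate means having more than one point). A continuum $X$ is chainable if for every $\varepsilon>0$ there are finitely many open sets $U_1,\ldots,U_n$ covering $X$ such that $\operatorname{diam}(U_i)<\varepsilon$ for all $i\le n$, and $U_i\cap U_j\neq\varnothing$ if and only if $|i-j|\leq 1$, for all $i,j\leq n$. A topological space is totally disconnected if it does not have any connected subset with more than one point. A topological space $Y$ is zero-dimensional at $y\in Y$ if every neighborhood of $y$ in $Y$ contains a clopen (in $Y$) neighborhood of $y$. *)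

(* Defs.v *)
From HB Require Import structures.
From mathcomp Require Import all_boot all_order all_algebra.
From mathcomp Require Import all_classical all_reals all_analysis borel_hierarchy.

Set Implicit Arguments.
Unset Strict Implicit.
Unset Printing Implicit Defensive.

Import Order.TTheory GRing.Theory Num.Theory.
Import numFieldNormedType.Exports.

Local Open Scope classical_set_scope.
Local Open Scope ring_scope.

(* A subset is a continuum when it is one in the subspace metric; the space X
   itself is a continuum when [continuum [set: X]]. *)
Definition continuum (R : realType) (X : metricType R) (A : set X) : Prop :=
  compact A /\ connected A.

Definition nondegenerate_set (T : Type) (A : set T) : Prop :=
  exists x y, [/\ A x, A y & x <> y].

Definition Suslinian (R : realType) (X : metricType R) : Prop :=
  ~ exists C : set (set X),
      [/\ ~ countable C,
          (forall A, C A -> continuum A /\ nondegenerate_set A) &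
          trivIset C id].

(* Valued in the extended reals, so that unbounded sets have diameter +oo.
   The empty set gets -oo; this convention is irrelevant in [chainable], where
   the case i = j of the intersection condition makes every link nonempty. *)
Definition diam (R : realType) (X : metricType R) (A : set X) : \bar R :=
  ereal_sup [set (mdist p.1 p.2)%:E | p in A `*` A].

Definition chainable (R : realType) (X : metricType R) : Prop :=
  forall eps : R, 0 < eps ->
    exists (n : nat) (U : 'I_n -> set X),
      [/\ (forall i, open (U i)),
          \bigcup_i U i = [set: X],
          (forall i, (diam (U i) < eps%:E)%E) &
          (forall i j : 'I_n,
             (U i `&` U j !=set0) <-> `|i%:Z - j%:Z| <= 1)].

(* Zero-dimensionality at a point, in the sense of small neighborhoods; the
   library's [zero_dimensional] is the global separation of points by clopen
   sets, which is a different notion. *)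
Definition zero_dimensional_at (Y : topologicalType) (y : Y) : Prop :=
  forall N : set Y, nbhs y N ->
    exists V : set Y, [/\ clopen V, nbhs y V & V `<=` N].

(* The library's [totally_disconnected], phrased with connected components,
   says that no connected subset has more than one point. *)
Lemma totally_disconnectedP (T : topologicalType) (A : set T) :
  totally_disconnected A <->
  ~ exists C : set T, [/\ C `<=` A, connected C & nondegenerate_set C].
Proof.
split=> [tdA [C [CA cC [x [y [Cx Cy xy]]]]]|ndA x Ax].
  apply: xy; have : connected_component A x y by exists C.
  by rewrite tdA//; exact: CA.
apply/seteqP; split=> [y [C [Cx CA cC] Cy]|y ->].
  apply: contrapT => /= yx; apply: ndA; exists C; split => //.
  by exists x, y; split => // xy; apply: yx.
exact: connected_component_refl.
Qed.

(* Main.v *)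
Require Import Defs.
From HB Require Import structures.
From mathcomp Require Import all_boot all_order all_algebra.
From mathcomp Require Import all_classical all_reals all_analysis borel_hierarchy.
From mathcomp Require Import zify.

Set Implicit Arguments.
Unset Strict Implicit.
Unset Printing Implicit Defensive.

Import Order.TTheory GRing.Theory Num.Theory.
Import numFieldNormedType.Exports.

Local Open Scope classical_set_scope.
Local Open Scope ring_scope.

(** Suppose that [E] is zero-dimensional at none of its points and let [Y] be
the closure of [E], a compact space. For a set [F] and [x] in [F] call
[qhull F x] the intersection of the closures of the relatively clopen subsets
of [F] that contain [x]. By compactness this is a continuum, whatever [F] is,
and it lies in an open set [O] only if some clopen neighbourhood of [x] in [F]
already has its closure in [O] ([connected_qhull], [qhull_open]).

Suslinianity enters through the Baire category theorem. Cover [X] by countably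
many open sets [U] of small diameter. The components of the compact sets
[Y `&` closure U] are pairwise disjoint, so only countably many of them are
nondegenerate. A degenerate one at a point of [E] in [U] would give that point
a small clopen neighbourhood in [E]. Hence a generic point of [E] is interior
relative to [Y] to small subcontinua of [Y]: at such a point [Y] is connected
im kleinen ([generic_conn_im_kleinen]). The Baire category theorem applies to
[E] because it is a G-delta.

Chainability enters through a total relation on [X] for which every
subcontinuum is order-convex: compare the indices of the links that contain two
points, and pass to the limit along an ultrafilter of finer and finer chains
([chainable_order]). If a continuum [C] is connected im kleinen at [g], then
the points of [C] below [g] and those above [g] are open in [C]
([below_above_separated]), so that intervals of [C] with such end points are
closed, and they are small around [g].

Now fix a generic point [e] of [E] and a subcontinuum [C] of [Y] that is a
neighbourhood of [e] in [Y]. Take a generic [b] above [e] and close to it, and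
let [F] be the trace of [E] on the interval from [e] to [b]. If the continuum
[qhull F e] contained [b], it would contain the whole interval by convexity.
Then every clopen part of [F] around [e] would be dense in [F], so [F] would be
connected, hence reduced to [e], a contradiction. So [e] has a clopen
neighbourhood in [F] that stays away from [b] ([one_sided_clopen]). Together
with its mirror image below [e] it is a small clopen neighbourhood of [e] in
[E] ([relclopen_at_conn_im_kleinen]), against the assumption on [E]. *)

(** * Relatively clopen sets and hulls of quasi-components *)

(** The sets [A `\` O] would otherwise generate a proper filter, and a cluster
point of it would lie in every [A] but not in [O]. *)
Lemma compact_directed_sub (T : topologicalType) (P : set (set T)) (O : set T) :
    compact [set: T] -> open O -> P !=set0 ->
    (forall A, P A -> closed A) ->
    (forall A B, P A -> P B -> exists2 D, P D & D `<=` A `&` B) ->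
  \bigcap_(A in P) A `<=` O -> exists2 A, P A & A `<=` O.
Proof.
move=> cT oO [A0 PA0] clP dirP PO; apply: contrapT => noA.
pose F : set_system T := filter_from P (fun A => A `\` O).
have FF : ProperFilter F.
  apply: filter_from_proper; last first.
    move=> A PA; apply: contrapT => /nonemptyPn AO; apply: noA; exists A => //.
    by rewrite -setD_eq0.
  apply: filter_from_filter; first by exists A0.
  move=> A B PA PB; have [D PD DAB] := dirP _ _ PA PB.
  exists D => // x [/DAB[Ax Bx] nOx]; by split; split.
have [p [_ clp]] := cT F FF filterT.
have inF A : P A -> closure (A `\` O) p.
  by move=> PA N Np; apply: clp => //; exists A.
have Op : O p.
  apply: PO => A PA; rewrite (closure_id A).1; last exact: clP.
  by apply: closureS (inF _ PA) => x [].
by have [x [[_ nOx] Ox]] := inF _ PA0 O (open_nbhs_nbhs (conj oO Op)).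
Qed.

(** Phrased like the library's [connected], so that a set [F] is connected when
it has no proper nonempty [relclopen] subset. *)
Definition relclopen (T : topologicalType) (F V : set T) :=
  (exists2 O, open O & V = F `&` O) /\ (exists2 D, closed D & V = F `&` D).

Lemma relclopen_sub (T : topologicalType) (F V : set T) :
  relclopen F V -> V `<=` F.
Proof. by move=> [[ O _ ->] _] x []. Qed.

Lemma relclopenT (T : topologicalType) (F : set T) : relclopen F F.
Proof. by split; exists setT; rewrite ?setIT//; exact: openT. Qed.

Lemma relclopenD (T : topologicalType) (F V : set T) :
  relclopen F V -> relclopen F (F `\` V).
Proof.
move=> [[ O oO VO] [D cD VD]]; split.
  by exists (~` D); rewrite ?VD ?setDIr ?setDv ?set0U ?setDE//; exact: closed_openC.
by exists (~` O); rewrite ?VO ?setDIr ?setDv ?set0U ?setDE//; exact: open_closedC.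
Qed.

Lemma relclopenI (T : topologicalType) (F V W : set T) :
  relclopen F V -> relclopen F W -> relclopen F (V `&` W).
Proof.
move=> [[ O oO ->] [D cD VD]] [[ O' oO' ->] [D' cD' WD]]; split.
  by exists (O `&` O'); [exact: openI|rewrite setIACA setIid].
exists (D `&` D'); first exact: closedI.
by rewrite VD WD setIACA setIid.
Qed.

Lemma relclopen_closure (T : topologicalType) (F V : set T) y :
  relclopen F V -> F y -> closure V y -> V y.
Proof.
by move=> [_ [D cD ->]] Fy /closureI[_]; rewrite -(closure_id _).1.
Qed.

Lemma relclopen_closureD (T : topologicalType) (F V : set T) y :
  relclopen F V -> V y -> ~ closure (F `\` V) y.
Proof.
move=> FV Vy clD.
have [_ //] := relclopen_closure (relclopenD FV) (relclopen_sub FV Vy) clD.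
Qed.

Lemma connected_relclopen (T : topologicalType) (K F V : set T) x :
  connected K -> K `<=` F -> relclopen F V -> K x -> V x -> K `<=` V.
Proof.
move=> cK KF [[ O oO VO] [D cD VD]] Kx Vx.
have KV : K `&` V = K.
  apply: cK; first by exists x.
    by exists O => //; rewrite VO setIA (setIidl KF).
  by exists D => //; rewrite VD setIA (setIidl KF).
by rewrite -KV => y [].
Qed.

(** The quasi-component of [x] in [F], except that closures are taken in the
ambient space. In a compact metric space it is the component of [x] in [F] when
[F] is closed, and in general it records which limit points cannot be cut off from [x] within [F]. *)
Definition qhull (T : topologicalType) (F : set T) (x : T) : set T :=
  \bigcap_(V in [set V | relclopen F V /\ V x]) closure V.

Lemma closed_qhull (T : topologicalType) (F : set T) x : closed (qhull F x).
Proof. by apply: closed_bigI => V _; exact: closed_closure. Qed.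

Lemma qhull_self (T : topologicalType) (F : set T) x : qhull F x x.
Proof. by move=> V [_ Vx]; exact: subset_closure. Qed.

Lemma qhull_sub (T : topologicalType) (F : set T) x :
  F x -> qhull F x `<=` closure F.
Proof. by move=> Fx y /(_ F); apply; split => //; exact: relclopenT. Qed.

Lemma qhull_closed_sub (T : topologicalType) (F : set T) x :
  closed F -> F x -> qhull F x `<=` F.
Proof. by move=> clF Fx y /(qhull_sub Fx); rewrite -(closure_id F).1. Qed.

Lemma qhull_open (T : topologicalType) (F O : set T) x :
    compact [set: T] -> F x -> open O -> qhull F x `<=` O ->
  exists V, [/\ relclopen F V, V x & closure V `<=` O].
Proof.
move=> cT Fx oO KO.
have [||||_ [V [FV Vx] <-] VO] :=
  @compact_directed_sub T [set closure V | V in [set V | relclopen F V /\ V x]]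
    O cT oO.
- by exists (closure F), F => //; split => //; exact: relclopenT.
- by move=> _ [V _ <-]; exact: closed_closure.
- move=> _ _ [V [FV Vx] <-] [W [FW Wx] <-].
  exists (closure (V `&` W)); last exact: closureI.
  by exists (V `&` W) => //; split => //; exact: relclopenI.
- by move=> y yV; apply: KO => V VP; apply: yV; exists V.
- by exists V.
Qed.

(** If the hull splits into closed pieces [K1] and [K2] with [x] in [K1], separate
them by disjoint open sets [U1] and [U2]. A clopen part [V] of [F] around [x]
has its closure in the union, so [V `&` U1] is again clopen in [F], and its
closure misses [K2]. *)
Lemma connected_qhull (R : realType) (X : pseudoMetricType R) (F : set X) x :
  compact [set: X] -> F x -> connected (qhull F x).
Proof.
move=> cX Fx B B0 [ O oO BO] [D cD BD].
set K := qhull F x in BO BD *.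
have cK : closed K by exact: closed_qhull.
suff key K1 K2 : closed K1 -> closed K2 -> K1 `&` K2 = set0 ->
    K = K1 `|` K2 -> K1 x -> K2 = set0.
  have cB : closed B by rewrite BD; exact: closedI.
  have cKB : closed (K `\` B).
    by rewrite BO setDIr setDv set0U setDE; apply: closedI => //; exact: open_closedC.
  have BK : B `<=` K by rewrite BO => y [].
  have KU : K = B `|` K `\` B by rewrite setDUK.
  have [Bx|nBx] := pselect (B x).
    have := key B (K `\` B) cB cKB (setDIK _ _) KU Bx.
    by move=> KB; rewrite [RHS]KU KB setU0.
  have B0' : B = set0.
    apply: (key (K `\` B) B) => //; first by rewrite setIC setDIK.
      by rewrite setUC.
    by split => //; exact: qhull_self.
  by move: B0 => [z]; rewrite B0'.
move=> c1 c2 K12 KU K1x.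
have [U1 [U2 [ o1 o2 KU1 KU2 U12]]] :=
  (@normal_openP R X).1 pseudometric_normal _ _ c1 c2 K12.
have [|V [FV Vx VU]] := qhull_open cX Fx (openU o1 o2).
  by rewrite -/K KU; exact: setUSS.
have FVU : relclopen F (V `&` U1).
  case: (FV) => -[ O' oO' VO'] [D' cD' VD']; split.
    by exists (O' `&` U1); [exact: openI|rewrite VO' setIA].
  exists (closure V `&` ~` U2).
    by apply: closedI; [exact: closed_closure|exact: open_closedC].
  apply/seteqP; split => y.
    move=> [Vy U1y]; split; first exact: relclopen_sub Vy.
    split; first exact: subset_closure.
    by move=> U2y; have : (U1 `&` U2) y by []; rewrite U12.
  move=> [Fy [Vy nU2y]]; split; first exact: relclopen_closure FV Fy Vy.
  by have [] := VU _ Vy.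
rewrite -subset0 => y K2y.
have Ky : K y by rewrite KU; right.
have := Ky _ (conj FVU (conj Vx (KU1 _ K1x))) _ (open_nbhs_nbhs (conj o2 (KU2 _ K2y))).
by move=> [z [[_ U1z] U2z]]; have : (U1 `&` U2) z by []; rewrite U12.
Qed.

(** Otherwise a clopen part of [C `\` B] around [x] misses [J], which surrounds
[B] in [C]; it is then clopen in [C] and, missing [B], it disconnects [C]. *)
Lemma boundary_bumping (R : realType) (X : pseudoMetricType R)
    (C B J : set X) x :
    compact [set: X] -> closed C -> connected C -> open B -> C `&` B !=set0 ->
    closed J -> C `&` B `<=` J -> C x -> ~ B x ->
  qhull (C `\` B) x `&` J !=set0.
Proof.
move=> cX clC cC oB [b [Cb Bb]] clJ CBJ Cx nBx; apply: contrapT => /nonemptyPn KJ.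
have [|||V [FV Vx VJ]] := @qhull_open _ (C `\` B) (~` J) x cX.
- by [].
- exact: closed_openC.
- by apply/disjoints_subset.
have CV : relclopen C V.
  case: (FV) => -[ O oO VO] [D cD VD]; split.
    exists (O `&` ~` J); first by apply: openI => //; exact: closed_openC.
    apply/seteqP; split => y.
      move=> Vy; have := Vy; rewrite {1}VO => -[[Cy _] Oy]; split => //.
      by split => //; apply: VJ; exact: subset_closure.
    move=> [Cy [Oy nJy]]; rewrite VO; split => //; split => // By.
    by apply: nJy; exact: CBJ.
  exists (~` B `&` D); last by rewrite VD setDE setIA.
  by apply: closedI => //; exact: open_closedC.
have := connected_relclopen cC (@subset_refl _ C) CV Cx Vx Cb.
by move=> /(relclopen_sub FV)[].
Qed.

(** In a closed set no clopen part separates [x] from [y], nor [x'] from [y], so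
none separates [x] from [x']. *)
Lemma qhull_meet (T : topologicalType) (F : set T) x x' y :
  closed F -> F x -> F x' -> qhull F x y -> qhull F x' y -> qhull F x = qhull F x'.
Proof.
move=> clF Fx Fx' xy x'y.
have Fy : F y by rewrite (closure_id F).1//; exact: qhull_sub xy.
have key z z' : F z' -> qhull F z y -> qhull F z' y ->
    forall V, relclopen F V -> V z -> V z'.
  move=> Fz' zy z'y V FV Vz; apply: contrapT => nVz'.
  have Vy : V y by apply: (relclopen_closure FV) => //; exact: zy.
  apply: (relclopen_closureD FV Vy); apply: z'y.
  by split; [exact: relclopenD|split].
apply/seteqP; split => w wF V [FV Vz]; apply: wF; split => //.
  exact: key Vz.
exact: key Vz.
Qed.

(** * An order on a chainable space *)

Lemma diam_mdist (R : realType) (X : metricType R) (A : set X) (e : R) x y :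
  (diam A < e%:E)%E -> A x -> A y -> mdist x y < e.
Proof.
move=> dA Ax Ay; rewrite -lte_fin; apply: le_lt_trans dA.
by apply: ereal_sup_ubound; exists (x, y).
Qed.

(** If [D] missed the link [U j], the links before [j] and those after [j] would
disconnect it, since links that are not adjacent are disjoint. *)
Lemma chain_between (X : topologicalType) (n : nat) (U : 'I_n -> set X)
    (D : set X) (i j k : 'I_n) x z :
    (forall i, open (U i)) -> \bigcup_i U i = [set: X] ->
    (forall i j : 'I_n, U i `&` U j !=set0 -> `|i%:Z - j%:Z| <= 1) ->
    connected D -> D x -> D z -> U i x -> U k z -> (i <= j <= k)%N ->
  D `&` U j !=set0.
Proof.
move=> oU cU adjU cD Dx Dz Ux Uz /andP[ij jk].
apply: contrapT => /nonemptyPn DUj.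
have notj l y : D y -> U l y -> l != j.
  by move=> Dy Uly; apply/eqP => lj; have : (D `&` U j) y; [rewrite -lj|rewrite DUj].
pose L := \bigcup_(l in [set l : 'I_n | (l < j)%N]) U l.
pose G := \bigcup_(l in [set l : 'I_n | (j < l)%N]) U l.
have oL : open L by apply: bigcup_open => l _; exact: oU.
have oG : open G by apply: bigcup_open => l _; exact: oU.
have LG : L `&` G = set0.
  rewrite -subset0 => y [[l /= lj Uly] [g /= jg Ugy]].
  have /adjU : U l `&` U g !=set0 by exists y.
  rewrite distrC; lia.
have DLG y : D y -> L y \/ G y.
  move=> Dy; have [l _ Uly] : (\bigcup_i U i) y by rewrite cU.
  have := notj _ _ Dy Uly; rewrite neq_ltn => /orP[lj|jl].
    by left; exists l.
  by right; exists l.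
have Lx : L x.
  by exists i => //=; rewrite ltn_neqAle ij andbT; exact: notj Dx Ux.
have Gz : G z.
  by exists k => //=; rewrite ltn_neqAle jk andbT eq_sym; exact: notj Dz Uz.
have DL : D `&` L = D.
  apply: cD; first by exists x.
    by exists L.
  exists (~` G); first exact: open_closedC.
  apply/seteqP; split => y [Dy].
    by move=> Ly; split => // Gy; have : (L `&` G) y by []; rewrite LG.
  by move=> nGy; split => //; have [] := DLG _ Dy.
have [_ Lz] : (D `&` L) z by rewrite DL.
by have : (L `&` G) z by []; rewrite LG.
Qed.

(** [f x] is the index of a link containing [x] in a chain of mesh less than [e]. *)
Lemma chain_index (R : realType) (X : metricType R) (e : R) :
    chainable X -> 0 < e ->
  exists f : X -> nat,
    (forall x y, f x = f y -> mdist x y < e) /\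
    (forall D x y z, connected D -> D x -> D z -> (f x <= f y <= f z)%N ->
       exists2 d, D d & mdist y d < e).
Proof.
move=> chX e0; have [n [U [ oU cU dU adjU]]] := chX _ e0.
have /choice[f fU] x : exists i, U i x.
  by have [i _ Uix] : (\bigcup_i U i) x by [rewrite cU]; exists i.
exists (fun x => f x); split.
  move=> x y fxy; apply: (diam_mdist (dU (f x))) => //.
  by have /val_inj -> : val (f x) = val (f y) by [].
move=> D x y z cD Dx Dz fxyz.
have [|d [Dd Ud]] := chain_between oU cU _ cD Dx Dz (fU x) (fU z) fxyz.
  by move=> i j /adjU.
by exists d => //; apply: (diam_mdist (dU (f y))).
Qed.

Definition order_convex (X : Type) (le : X -> X -> Prop) (D : set X) :=
  forall x y z, D x -> D z -> le x y -> le y z -> D y.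

Definition chain_order (X : topologicalType) (le : X -> X -> Prop) :=
  [/\ (forall x y, le x y \/ le y x),
      (forall x y, le x y -> le y x -> x = y) &
      (forall D, closed D -> connected D -> order_convex le D)].

(** A limit, along an ultrafilter, of the orders by link index in chains whose
mesh tends to 0. The ultrafilter makes the limit total and lets two comparisons
be read in a common fine chain. There a connected set that contains [x] and [z]
meets the link of every point [y] in between, so it comes arbitrarily close to
[y]. *)
Lemma chainable_order (R : realType) (X : metricType R) :
  chainable X -> exists le : X -> X -> Prop, chain_order le.
Proof.
move=> chX.
have mesh0 (m : nat) : (0 : R) < m.+1%:R^-1 by rewrite invr_gt0.
have /choice[f fP] m := chain_index chX (mesh0 m).
have [G [GU ooG]] := ultraFilterLemma (@eventually_filter).
have PG : ProperFilter G := ultra_proper.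
have small (e : R) : 0 < e -> G [set m | (m.+1%:R^-1 : R) < e].
  move=> e0; apply: ooG; exact: near_infty_natSinv_lt (PosNum e0).
exists (fun x y => G [set m | (f m x <= f m y)%N]); split.
- move=> x y; have [|] := in_ultra_setVsetC [set m | (f m x <= f m y)%N] GU.
    by left.
  by move=> Gn; right; apply: filterS Gn => m /= /negP; rewrite -ltnNge => /ltnW.
- move=> x y xy yx; apply: contrapT => /eqP; rewrite -mdist_gt0 => d0.
  have [m /= [[mxy myx] md]] := filter_ex (filterI (filterI xy yx) (small _ d0)).
  have /(fP m).1 : f m x = f m y by apply/eqP; rewrite eqn_leq mxy.
  by rewrite ltNge (ltW md).
- move=> D clD cD x y z Dx Dz xy yz.
  rewrite (closure_id D).1// => N; rewrite -nbhs_ballE => -[e /= e0 eN].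
  have [m /= [[mxy myz] md]] := filter_ex (filterI (filterI xy yz) (small _ e0)).
  have [|d Dd yd] := (fP m).2 D x y z cD Dx Dz; first by rewrite mxy.
  by exists d; split => //; apply: eN; rewrite ballEmdist/=; exact: lt_trans yd md.
Qed.

(** * Cutting a continuum at points of connectedness im kleinen *)

Lemma chain_order_flip (X : topologicalType) (le : X -> X -> Prop) :
  chain_order le -> chain_order (fun x y => le y x).
Proof.
move=> [tot anti conv]; split.
- by move=> x y; exact: tot.
- by move=> x y yx xy; exact: anti.
- by move=> D clD cD x y z Dx Dz yx zy; exact: conv cD _ _ _ Dz Dx zy yx.
Qed.

Definition below (X : Type) (le : X -> X -> Prop) (C : set X) (g : X) : set X :=
  [set y | C y /\ (le y g /\ y <> g)].

(** Going through the converse relation lets every statement about one side of [g]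
apply to the other side by [chain_order_flip]. *)
Definition above (X : Type) (le : X -> X -> Prop) := below (fun x y => le y x).

(** A continuum with points on both sides of [g] contains [g] by convexity. *)
Lemma below_connected (X : topologicalType) (le : X -> X -> Prop)
    (C Z : set X) g x :
    chain_order le -> closed Z -> connected Z -> Z `<=` C -> ~ Z g ->
    Z x -> below le C g x -> Z `<=` below le C g.
Proof.
move=> [tot anti conv] clZ cZ ZC nZg Zx [_ [xg _]] z Zz; split; first exact: ZC.
split; last by move=> zg; apply: nZg; rewrite -zg.
have [//|gz] := tot z g.
by exfalso; apply: nZg; exact: conv Zx Zz xg gz.
Qed.

Lemma qhull_below (R : realType) (X : metricType R) (le : X -> X -> Prop)
    (C B : set X) g x :
    compact [set: X] -> chain_order le -> closed C -> open B -> B g ->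
    below le C g x -> ~ B x ->
  qhull (C `\` B) x `<=` below le C g.
Proof.
move=> cX cole clC oB Bg Lx nBx.
have Fx : (C `\` B) x by split => //; case: Lx.
have clF : closed (C `\` B).
  by rewrite setDE; apply: closedI => //; exact: open_closedC.
have KF := qhull_closed_sub clF Fx.
apply: below_connected cole _ _ _ _ (@qhull_self _ _ x) Lx.
- exact: closed_qhull.
- exact: connected_qhull cX Fx.
- by move=> y /KF[].
- by move=> /KF[].
Qed.

Definition conn_im_kleinen (X : topologicalType) (C : set X) (g : X) :=
  forall N, open N -> N g -> exists J B,
    [/\ closed J, connected J, J `<=` C `&` N & [/\ open B, B g & C `&` B `<=` J]].

Lemma above_not_below (X : topologicalType) (le : X -> X -> Prop) (C : set X) g y :
  chain_order le -> above le C g y -> ~ below le C g y.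
Proof. by move=> [_ anti _] [_ [gy yg]] [_ [/anti/(_ gy)]]. Qed.

Lemma closed_point (R : realType) (X : metricType R) (x : X) : closed [set x].
Proof.
exact/accessible_closed_set1/hausdorff_accessible/metric_hausdorff.
Qed.

(** If some point [x] above [g] is a limit of points below [g], then such limits
occur in every neighbourhood [J] of [g]. Indeed the component of [x] in
[closure (below le C g) `\` B] stays above [g], and it reaches [J]. Otherwise a
clopen part of that set around [x] would miss [J], yet it contains points [x']
below [g], whose components in [C `\` B] stay below [g] and reach [J]. *)
Lemma closure_below_reaches (R : realType) (X : metricType R)
    (le : X -> X -> Prop) (C J B : set X) g x :
    compact [set: X] -> chain_order le -> closed C -> connected C ->
    C g -> closed J -> open B -> B g -> C `&` B `<=` J ->
    closure (below le C g) x -> above le C g x -> ~ J x ->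
  exists y, [/\ closure (below le C g) y, above le C g y & J y].
Proof.
move=> cX cole clC cC Cg clJ oB Bg CBJ clx ax nJx.
have colef := chain_order_flip cole.
have Cx : C x by case: ax.
have nBx : ~ B x by move=> Bx; apply: nJx; exact: CBJ.
have clLC : closure (below le C g) `<=` C.
  by rewrite [X in _ `<=` X](closure_id C).1//; apply: closureS => ? [].
set W := closure (below le C g) `\` B.
have clW : closed W.
  by apply: closedI; [exact: closed_closure|exact: open_closedC].
have Wx : W x by [].
have KW := qhull_closed_sub clW Wx.
suff [y [Ky Jy]] : qhull W x `&` J !=set0.
  have [Wy _] := KW _ Ky; exists y; split => //.
  apply: below_connected colef _ _ _ _ (@qhull_self _ W x) ax _ Ky.
  - exact: closed_qhull.
  - exact: connected_qhull cX Wx.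
  - by move=> z /KW[/clLC].
  - by move=> /KW[].
apply: contrapT => /nonemptyPn KJ.
have [||V [WV Vx VJ]] := @qhull_open _ W (~` J) x cX Wx.
- exact: closed_openC.
- by apply/disjoints_subset.
have clWV : closed (W `\` V).
  by case: WV => -[ O oO ->] _; rewrite setDIr setDv set0U setDE; apply: closedI => //;
    exact: open_closedC.
have oN : open (~` J `&` ~` (W `\` V)) by apply: openI; exact: closed_openC.
have [|x' [Lx' [nJx' nWVx']]] := clx _ (open_nbhs_nbhs (conj oN _)).
  by split => // -[_]; apply.
have Cx' : C x' by case: Lx'.
have nBx' : ~ B x' by move=> Bx'; apply: nJx'; exact: CBJ.
have Wx' : W x' by split => //; exact: subset_closure.
have Vx' : V x' by apply: contrapT => nVx'; exact: nWVx'.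
have [|z [Kz Jz]] := boundary_bumping cX clC cC oB _ clJ CBJ Cx' nBx'.
  by exists g.
have Fx' : (C `\` B) x' by [].
have clF : closed (C `\` B).
  by rewrite setDE; apply: closedI => //; exact: open_closedC.
have KL := qhull_below cX cole clC oB Bg Lx' nBx'.
have KW' : qhull (C `\` B) x' `<=` W.
  move=> y Ky; split; first exact/subset_closure/KL.
  by case: (qhull_closed_sub clF Fx' Ky).
have := connected_relclopen (connected_qhull cX Fx') KW' WV (@qhull_self _ _ x') Vx' Kz.
by move=> /subset_closure/VJ; apply.
Qed.

(** If [x] above [g] were a limit of points below [g], there would be such limits
[y] arbitrarily close to [g]. For every [x1] below [g] some continuum contains
[x1] and [g] but not [y], so that points of [C] below [g] and near [y] precede
[x1]; thus [x1] lies between two points close to [g]. As small continua around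
[g] are convex, [x1] is arbitrarily close to [g]: a contradiction. *)
Lemma below_above_separated (R : realType) (X : metricType R)
    (le : X -> X -> Prop) (C : set X) g :
    compact [set: X] -> chain_order le -> closed C -> connected C -> C g ->
    conn_im_kleinen C g ->
  closure (below le C g) `&` above le C g = set0.
Proof.
move=> cX cole clC cC Cg cik; rewrite -subset0 => x [clx ax].
have [tot anti conv] := cole.
have openC1 (y : X) : open (~` [set y]) by exact/closed_openC/closed_point.
(* I consists of a component of x1 off a neighbourhood of g, which stays below g,
   and of a small continuum around g. *)
have avoid x1 y : below le C g x1 -> above le C g y ->
    exists I, [/\ closed I, connected I, I x1, I g & ~ I y].
  move=> Lx1 Ry.
  have [|J [B [clJ cJ JCN [oB Bg CBJ]]]] := cik _ (openC1 y).
    by case: Ry => _ [_ yg] /= gy; apply: yg.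
  have Jg : J g by apply: CBJ.
  have nJy : ~ J y by move=> /JCN[_]; apply.
  have Cx1 : C x1 by case: Lx1.
  have [Jx1|nJx1] := pselect (J x1); first by exists J.
  have nBx1 : ~ B x1 by move=> Bx1; apply: nJx1; exact: CBJ.
  have Fx1 : (C `\` B) x1 by [].
  have [|z [Kz Jz]] := boundary_bumping cX clC cC oB _ clJ CBJ Cx1 nBx1.
    by exists g.
  exists (qhull (C `\` B) x1 `|` J); split.
  - by apply: closedU => //; exact: closed_qhull.
  - apply: connectedU => //; [by exists z|exact: connected_qhull].
  - by left; exact: qhull_self.
  - by right.
  - move=> [Ky|//]; apply: (above_not_below cole Ry).
    exact: qhull_below cX cole clC oB Bg Lx1 nBx1 _ Ky.
(* It is enough to show that x1 belongs to every continuum J around g. A point y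
   of J above g is the limit of points z of J below g. By convexity of I, those
   close to y lie below x1, and then convexity of J gives x1. *)
have [x1 [Lx1 _]] := clx _ filterT.
have [|J [B [clJ cJ JCN [oB Bg CBJ]]]] := cik _ (openC1 x1).
  by case: Lx1 => _ [_ x1g] /= gx1; apply: x1g.
have [||J2 [B2 [clJ2 cJ2 JCN2 [oB2 Bg2 CBJ2]]]] := cik (B `&` ~` [set x]).
- exact: openI.
- by split => // gx; case: ax => _ [_]; apply.
have nJ2x : ~ J2 x by move=> /JCN2[_ []] _; apply.
have [y [cly Ry J2y]] :=
  closure_below_reaches cX cole clC cC Cg clJ2 oB2 Bg2 CBJ2 clx ax nJ2x.
have By : B y by case: (JCN2 _ J2y) => _ [].
have [I [clI cI Ix1 Ig nIy]] := avoid _ _ Lx1 Ry.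
have oN : open (B `&` ~` I) by apply: openI => //; exact: closed_openC.
have [z [Lz [Bz nIz]]] := cly _ (open_nbhs_nbhs (conj oN (conj By nIy))).
have Jz : J z by apply: CBJ; split => //; case: Lz.
have zx1 : le z x1.
  have [//|x1z] := tot z x1; exfalso; apply: nIz.
  by case: Lz => _ [zg _]; exact: conv Ix1 Ig x1z zg.
have : J x1.
  by case: Lx1 => _ [x1g _]; apply: conv zx1 x1g => //; exact: CBJ.
by move=> /JCN[_]; apply.
Qed.

Lemma closed_from (R : realType) (X : metricType R)
    (le : X -> X -> Prop) (C : set X) g :
    compact [set: X] -> chain_order le -> closed C -> connected C -> C g ->
    conn_im_kleinen C g ->
  closed (C `&` [set y | le g y]).
Proof.
move=> cX cole clC cC Cg cik y cly; have [tot anti conv] := cole.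
have Cy : C y by rewrite (closure_id C).1//; case: (closureI cly).
split=> //=; have [yg|//] := tot y g.
have [<-|gy] := pselect (g = y); first by case: (tot g g).
have Ly : above (fun x y => le y x) C g y by split => //; split => //; exact/nesym.
have sep := below_above_separated cX (chain_order_flip cole) clC cC Cg cik.
have oN : open (~` [set g] : set X) by exact/closed_openC/closed_point.
exfalso; rewrite -[False]/(set0 y) -sep; split => //= N Ny.
have [z [[Cz gz] [/= zg Nz]]] :=
  cly _ (filterI (open_nbhs_nbhs (conj oN (nesym gy))) Ny).
by exists z; split.
Qed.

(** * Clopen neighbourhoods in a totally disconnected set *)

(** The half of [E] at and above [e] has small relatively clopen sets around [e].
The open set [U] and the closed set [D] witness clopenness, in a form in which
the two halves can be glued. *)
Lemma one_sided_clopen (R : realType) (X : metricType R)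
    (le : X -> X -> Prop) (E C N P : set X) e :
    compact [set: X] -> chain_order le -> totally_disconnected E ->
    closed C -> connected C -> E e -> C e -> conn_im_kleinen C e ->
    open N -> N e -> open P -> P e ->
    (forall Q, open Q -> Q `<=` P -> C `&` Q !=set0 ->
      exists b, [/\ C b, Q b & conn_im_kleinen C b]) ->
  exists U D, [/\ open U, closed D, U e,
    E `&` (C `&` [set y | le e y]) `&` U = E `&` (C `&` [set y | le e y]) `&` D &
    E `&` (C `&` [set y | le e y]) `&` D `<=` N].
Proof.
move=> cX cole tdE clC cC Ee Ce cike oN Ne oP Pe dense_cik.
have [tot anti conv] := cole.
have colef := chain_order_flip cole.
have lee : le e e by case: (tot e e).
have cl1 := @closed_point R X.
have [J [B [clJ cJ JCN [oB Be CBJ]]]] := cike _ (openI oN oP) (conj Ne Pe).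
(* When no point of C above e is near e, the singleton of e is the half sought. *)
have [[b0 [Bb0 Rb0]]|noR] := pselect (B `&` above le C e !=set0); last first.
  exists B, [set e]; split => //.
    apply/seteqP; split => y [[Ey [Cy /= ey]]].
      move=> By; split => //=; apply: contrapT => ye.
      by apply: noR; exists y; split.
    by move=> ->.
  by move=> y [_ ->].
have sepe := below_above_separated cX cole clC cC Ce cike.
have [b [Cb [[Bb Pb] [nLb nbe]] cikb]] : exists b,
    [/\ C b, ((B `&` P) `&` (~` closure (below le C e) `&` ~` [set e])) b &
      conn_im_kleinen C b].
  apply: dense_cik.
  - apply: openI; first exact: openI.
    by apply: openI; apply: closed_openC => //; exact: closed_closure.
  - by move=> y [[]].
  - exists b0; have [Cb0 [_ b0e]] := Rb0; split => //; split; split => //.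
      by have [_ []] := JCN _ (CBJ _ (conj Cb0 Bb0)).
    by move=> Lb0; rewrite -[False]/(set0 b0) -sepe.
have eb : le e b.
  have [//|be] := tot e b; exfalso; apply: nLb; apply: subset_closure.
  by split.
have Jb : J b by apply: CBJ.
have Je : J e by apply: CBJ.
have clge : closed (C `&` [set y | le e y]) by exact: closed_from.
have clle : closed (C `&` [set y | le y b]).
  exact: (closed_from cX colef).
pose I := C `&` [set y | le e y] `&` (C `&` [set y | le y b]).
have clI : closed I by exact: closedI.
have IJ : I `<=` J by move=> y [[_ ey] [_ yb]]; exact: conv Je Jb ey yb.
pose F := E `&` I.
have Fe : F e by [].
(* A hull containing b would contain all of I by convexity, and F would be a
   connected subset of E with more than one point. *)
have nKb : ~ qhull F e b.
  move=> Kb.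
  have IK : I `<=` qhull F e.
    move=> y [[_ ey] [_ yb]].
    have cK := connected_qhull cX Fe.
    exact: (conv _ (@closed_qhull _ F e) cK) (@qhull_self _ F e) Kb ey yb.
  have full V : relclopen F V -> V e -> V = F.
    move=> FV Ve; apply/seteqP; split; first exact: relclopen_sub.
    move=> y Fy; apply: (relclopen_closure FV) => //.
    by apply: (IK y) => //; case: Fy.
  have cF : connected F.
    move=> V [v Vv] oV cV; have FV : relclopen F V by split.
    have [Ve|nVe] := pselect (V e); first exact: full.
    have FVF := full _ (relclopenD FV) (conj Fe nVe).
    by have := relclopen_sub FV Vv; rewrite -FVF => -[].
  have Fs : F `<=` [set e].
    move=> y Fy; apply: contrapT => ye.
    apply: (totally_disconnectedP E).1 tdE _; exists F; split => //.
      by move=> z [].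
    by exists e, y; split => //; exact/nesym.
  have /(closureS Fs) : closure F b by exact: qhull_sub Kb.
  by rewrite -(closure_id _).1.
have [|V [FV Ve Vb]] := qhull_open cX Fe (closed_openC (cl1 b)).
  by move=> y Ky /= yb; apply: nKb; rewrite -yb.
have VF := relclopen_sub FV.
have VI : closure V `<=` I.
  rewrite [X in _ `<=` X](closure_id I).1//; apply: closureS.
  by move=> y /VF[].
have VE : E `&` (C `&` [set y | le e y]) `&` closure V = V.
  apply/seteqP; split => y.
    by move=> [[Ey _] Vy]; apply: (relclopen_closure FV) => //; split => //; exact: VI.
  move=> Vy; have [Ey [Hy _]] := VF _ Vy.
  by split; [split|exact: subset_closure].
exists (~` closure (F `\` V) `&` (~` closure (above le C b) `&` ~` [set b])), (closure V).
rewrite VE; split => //.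
- apply: openI; first by apply: closed_openC; exact: closed_closure.
  by apply: openI; apply: closed_openC => //; exact: closed_closure.
- exact: closed_closure.
- split; first exact: relclopen_closureD FV Ve.
  split; last by move=> /esym.
  have sepb := below_above_separated cX colef clC cC Cb cikb.
  move=> clab; rewrite -[False]/(set0 e) -sepb; split => //; split => //.
  by split => //; exact/nesym.
- apply/seteqP; split => y.
    move=> [[Ey [Cy ey]] [nFVy [nay yb]]].
    have Fy : F y.
      split => //; split => //; split => //=.
      have [//|by_] := tot y b; exfalso; apply: nay; apply: subset_closure.
      by split.
    by apply: contrapT => nVy; apply: nFVy; apply: subset_closure.
  move=> Vy; have [Ey [Hy [_ yb]]] := VF _ Vy.
  have yneb : y <> b by move=> yb'; apply: (Vb y) => //; exact: subset_closure.
  split; first by split.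
  split; first exact: relclopen_closureD FV Vy.
  split => //.
  have sepb := below_above_separated cX colef clC cC Cb cikb.
  move=> clab; rewrite -[False]/(set0 y) -sepb; split => //.
  by split; [case: Hy|split].
- by move=> y /VF[_ /IJ/JCN[_ []]].
Qed.

(** The two halves of [C] at [e] are closed and meet only in [e]. So the union of
one-sided clopen sets is closed; it is open at [e] because of both open
witnesses, and at any other point because the opposite half is closed and does
not contain that point. *)
Lemma relclopen_at_conn_im_kleinen (R : realType) (X : metricType R)
    (le : X -> X -> Prop) (E C N P : set X) e :
    compact [set: X] -> chain_order le -> totally_disconnected E ->
    closed C -> connected C -> E e -> C e -> conn_im_kleinen C e ->
    open N -> N e -> open P -> P e -> E `&` P `<=` C ->
    (forall Q, open Q -> Q `<=` P -> C `&` Q !=set0 ->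
      exists b, [/\ C b, Q b & conn_im_kleinen C b]) ->
  exists V, [/\ relclopen E V, V e & V `<=` N].
Proof.
move=> cX cole tdE clC cC Ee Ce cike oN Ne oP Pe EPC dense_cik.
have colef := chain_order_flip cole; have [tot anti conv] := cole.
have [U1 [D1 [oU1 cD1 Ue1 UD1 DN1]]] := one_sided_clopen cX cole tdE clC cC Ee Ce cike
  (openI oN oP) (conj Ne Pe) oP Pe dense_cik.
have [U2 [D2 [oU2 cD2 Ue2 UD2 DN2]]] := one_sided_clopen cX colef tdE clC cC Ee Ce cike
  (openI oN oP) (conj Ne Pe) oP Pe dense_cik.
set H1 := C `&` [set y | le e y] in UD1 DN1.
set H2 := C `&` [set y | le y e] in UD2 DN2.
have cH1 : closed H1 by exact: closed_from.
have cH2 : closed H2 by exact: (closed_from cX colef).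
have lee : le e e by case: (tot e e).
pose V := E `&` (H1 `&` D1 `|` H2 `&` D2).
exists V; split.
- split; last by exists (H1 `&` D1 `|` H2 `&` D2) => //; apply: closedU; exact: closedI.
  exists (P `&` (U1 `&` U2 `|` (U1 `&` ~` H2 `|` U2 `&` ~` H1))).
    apply: openI => //; apply: openU; first exact: openI.
    by apply: openU; apply: openI => //; exact: closed_openC.
  have D1U1 y : E y -> H1 y -> D1 y <-> U1 y.
    move=> Ey Hy; split => Dy.
      by have : (E `&` H1 `&` D1) y by []; rewrite -UD1 => -[].
    by have : (E `&` H1 `&` U1) y by []; rewrite UD1 => -[].
  have D2U2 y : E y -> H2 y -> D2 y <-> U2 y.
    move=> Ey Hy; split => Dy.
      by have : (E `&` H2 `&` D2) y by []; rewrite -UD2 => -[].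
    by have : (E `&` H2 `&` U2) y by []; rewrite UD2 => -[].
  have H12 y : H1 y -> H2 y -> y = e.
    by move=> [_ /= ey] [_ /= ye]; exact: anti.
  apply/seteqP; split => y.
    move=> [Ey [[Hy Dy]|[Hy Dy]]]; split => //.
      split; first by have /DN1[] : (E `&` H1 `&` D1) y by [].
      have U1y : U1 y by apply/D1U1.
      have [H2y|nH2y] := pselect (H2 y); last by right; left.
      by left; rewrite (H12 _ Hy H2y).
    split; first by have /DN2[] : (E `&` H2 `&` D2) y by [].
    have U2y : U2 y by apply/D2U2.
    have [H1y|nH1y] := pselect (H1 y); last by right; right.
    by left; rewrite (H12 _ H1y Hy).
  move=> [Ey [Py Uy]]; have Cy : C y by exact: EPC.
  split => //; case: Uy => [[U1y U2y]|[[U1y nH2]|[U2y nH1]]].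
  + have [ey|ye] := tot e y.
      by left; split; [split|apply/D1U1; [|split|]].
    by right; split; [split|apply/D2U2; [|split|]].
  + have H1y : H1 y.
      by split => //=; have [//|ye] := tot e y; exfalso; apply: nH2.
    by left; split => //; apply/D1U1.
  + have H2y : H2 y.
      by split => //=; have [//|ye] := tot y e; exfalso; apply: nH1.
    by right; split => //; apply/D2U2.
- split => //; left; split; first by split.
  have : (E `&` H1 `&` U1) e by split => //; split => //; split.
  by rewrite UD1 => -[].
- move=> y [Ey [[Hy Dy]|[Hy Dy]]].
    by have /DN1[] : (E `&` H1 `&` D1) y by [].
  by have /DN2[] : (E `&` H2 `&` D2) y by [].
Qed.

(** * Generic points of a G-delta set *)

Lemma countable_qhulls (R : realType) (X : metricType R) (F : set X) :
    compact [set: X] -> Suslinian X -> closed F ->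
  countable [set D | nondegenerate_set D /\ exists2 x, F x & D = qhull F x].
Proof.
move=> cX sX clF; apply: contrapT => ncount; apply: sX.
exists [set D | nondegenerate_set D /\ exists2 x, F x & D = qhull F x].
split => //.
- move=> D [ndD [x Fx DE]]; split => //; rewrite DE; split.
    by apply: subclosed_compact cX _ => //; exact: closed_qhull.
  exact: connected_qhull.
- move=> _ _ [_ [x Fx ->]] [_ [x' Fx' ->]] [y [/= xy x'y]].
  exact: qhull_meet xy x'y.
Qed.

Definition dense_in (T : topologicalType) (Y U : set T) :=
  forall P, open P -> Y `&` P !=set0 -> Y `&` (P `&` U) !=set0.

(** Baire's theorem relative to a closed subset [Y] of a compact space, by a
shrinking sequence of open sets that meet [Y]. *)
Lemma compact_Baire (R : realType) (X : pseudoMetricType R) (Y : set X)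
    (U : nat -> set X) (P : set X) :
    compact [set: X] -> closed Y -> (forall n, open (U n)) ->
    (forall n, dense_in Y (U n)) -> open P -> Y `&` P !=set0 ->
  exists y, [/\ Y y, P y & forall n, U n y].
Proof.
move=> cX clY oU dU oP YP.
pose S := {Q : set X | open Q /\ Y `&` Q !=set0}.
have step (nQ : nat * S) : exists Q' : S,
    closure (sval Q') `<=` sval nQ.2 `&` U nQ.1.
  case: nQ => n [Q [oQ YQ]] /=.
  have [y [Yy QUy]] := dU n _ oQ YQ.
  have [V Vy VQ] := uniform_regular (open_nbhs_nbhs (conj (openI oQ (oU n)) QUy)).
  have oV : open V° /\ Y `&` V° !=set0.
    by split; [exact: open_interior|exists y].
  exists (exist (fun Q => open Q /\ Y `&` Q !=set0) _ oV) => /=.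
  exact: subset_trans (closureS (@interior_subset _ V)) VQ.
have [f fP] := choice step.
pose Q := fix Q n : S := if n is n'.+1 then f (n', Q n') else
  exist (fun Q => open Q /\ Y `&` Q !=set0) P (conj oP YP).
have QS n : closure (sval (Q n.+1)) `<=` sval (Q n) `&` U n by exact: (fP (n, Q n)).
have Qmono m n : (m <= n)%N -> sval (Q n) `<=` sval (Q m).
  elim: n => [|n IH]; first by rewrite leqn0 => /eqP ->.
  rewrite leq_eqVlt => /orP[/eqP -> //|/IH]; apply: subset_trans.
  by move=> y /subset_closure/QS[].
suff [y yQ] : \bigcap_(A in range (fun n => Y `&` closure (sval (Q n)))) A !=set0.
  have inQ n : sval (Q n) y /\ U n y.
    by apply: QS; have [] := yQ _ (ex_intro2 _ _ n.+1 I erefl).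
  exists y; split; first by have [] := yQ _ (ex_intro2 _ _ 0%N I erefl).
    by case: (inQ 0%N).
  by move=> n; case: (inQ n).
apply: contrapT => /nonemptyPn Q0.
have [||||A [n _ <-] A0] :=
  @compact_directed_sub X (range (fun n => Y `&` closure (sval (Q n)))) set0 cX open0.
- by exists (Y `&` closure (sval (Q 0%N))), 0%N.
- by move=> _ [n _ <-]; apply: closedI => //; exact: closed_closure.
- move=> _ _ [m _ <-] [n _ <-].
  exists (Y `&` closure (sval (Q (maxn m n)))); first by exists (maxn m n).
  move=> y [Yy Qy]; split; split => //; move: Qy; apply: closureS; apply: Qmono.
    exact: leq_maxl.
  exact: leq_maxr.
- by rewrite Q0.
have [_ [y [Yy Qy]]] := svalP (Q n).
by apply: (A0 y); split => //; exact: subset_closure.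
Qed.

(** The relative boundary of a closed set is closed and nowhere dense, so by Baire
some point of [E] avoids those of countably many closed sets. *)
Lemma Gdelta_generic (R : realType) (X : pseudoMetricType R) (E P : set X)
    (DD : set (set X)) :
    compact [set: X] -> Gdelta E -> countable DD -> (forall D, DD D -> closed D) ->
    open P -> closure E `&` P !=set0 ->
  exists e, [/\ E e, P e & forall D, DD D -> D e ->
    exists B, [/\ open B, B e & closure E `&` B `<=` D]].
Proof.
move=> cX [F oF EF] /countable_injP[f finj] clDD oP EP.
(* g enumerates DD; taking the closure makes all its values closed, including the
   default ones at the indices that f does not reach. *)
pose g n : set X := closure (get (fun D => DD D /\ f D = n)).
have gf D : DD D -> g (f D) = D.
  move=> DDD; rewrite /g.
  have /getPex[DDg fg] : exists D', DD D' /\ f D' = f D by exists D.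
  have -> : get (fun D' => DD D' /\ f D' = f D) = D.
    by apply: finj fg; exact: mem_set.
  by rewrite -(closure_id _).1//; exact: clDD.
pose W (D : set X) := \bigcup_(B in [set B | open B /\ closure E `&` B `<=` D]) B.
pose U n := F n `&` (~` g n `|` W (g n)).
have [|||e [Ye Pe Ue]] := @compact_Baire R X (closure E) U P cX _ _ _ oP EP.
- exact: closed_closure.
- move=> n; apply: openI => //; apply: openU.
    by apply: closed_openC; exact: closed_closure.
  by apply: bigcup_open => B [].
- move=> n Q oQ [y [Yy Qy]].
  have [z [Ez Qz]] := Yy _ (open_nbhs_nbhs (conj oQ Qy)).
  have Fz : F n z by move: Ez; rewrite EF; apply.
  have [sub|nsub] := pselect (closure E `&` (Q `&` F n) `<=` g n).
    exists z; split; first exact: subset_closure.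
    split => //; split => //; right; exists (Q `&` F n) => //; split => //.
    exact: openI.
  have [w [[Yw [Qw Fw]] ngw]] : (closure E `&` (Q `&` F n)) `\` g n !=set0.
    apply: contrapT => /nonemptyPn; rewrite setD_eq0; exact: nsub.
  by exists w; split => //; split => //; split => //; left.
exists e; split => //; first by rewrite EF => n _; case: (Ue n).
move=> D DDD De; have [_] := Ue (f D); rewrite gf// => -[//|[B [oB BD] Be]].
by exists B.
Qed.

Lemma small_open_cover (R : realType) (X : metricType R) (e : R) :
    chainable X -> 0 < e ->
  exists U : nat -> set X,
    [/\ (forall i, open (U i)), (forall x, exists i, U i x) &
        (forall i x y, U i x -> U i y -> mdist x y < e)].
Proof.
move=> chX e0; have [n [U [ oU cU dU _]]] := chX _ e0.
exists (fun i => if insub i is Some j then U j else set0); split.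
- by move=> i; case: insubP => [j _ _|_]; [exact: oU|exact: open0].
- move=> x; have [i _ Uix] : (\bigcup_i U i) x by rewrite cU.
  by exists i; rewrite valK.
- move=> i x y; case: insubP => [j _ _|_] //; exact: diam_mdist (dU j).
Qed.

Lemma conn_im_kleinen_sub (T : topologicalType) (Y C B : set T) g :
  C `<=` Y -> open B -> B g -> Y `&` B `<=` C -> conn_im_kleinen Y g ->
  conn_im_kleinen C g.
Proof.
move=> CY oB Bg YBC cik N oN Ng.
have [J [B' [clJ cJ JYN [oB' B'g YBJ]]]] := cik _ (openI oN oB) (conj Ng Bg).
exists J, B'; split => //.
  by move=> y /JYN[Yy [Ny By]]; split => //; exact: YBC.
by split => //; apply: subset_trans YBJ; exact: setSI.
Qed.

(** A generic point [e] is interior, relative to [closure E], to every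
nondegenerate component through [e] of the sets [closure E `&` closure U] with
[U] in countable covers of mesh tending to 0. Those components are small and
they cannot be degenerate: by [qhull_open], a component reduced to [e] would
give small clopen neighbourhoods of [e] in [E]. *)
Lemma generic_conn_im_kleinen (R : realType) (X : metricType R) (E : set X)
    (cX : compact [set: X]) (sX : Suslinian X) (chX : chainable X)
    (gE : Gdelta E)
    (nzd : forall e, E e -> exists N, [/\ open N, N e &
       ~ exists V, [/\ relclopen E V, V e & V `<=` N]]) (P : set X) :
  open P -> closure E `&` P !=set0 ->
  exists e, [/\ E e, P e & conn_im_kleinen (closure E) e].
Proof.
move=> oP EP; set Y := closure E.
have clY : closed Y by exact: closed_closure.
have mesh0 (m : nat) : (0 : R) < m.+1%:R^-1 by rewrite invr_gt0.
have /choice[U UP] m := small_open_cover chX (mesh0 m).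
pose F m i := Y `&` closure (U m i).
have clF m i : closed (F m i) by apply: closedI => //; exact: closed_closure.
pose DD : set (set X) := \bigcup_m \bigcup_i
  [set D | nondegenerate_set D /\ exists2 x, F m i x & D = qhull (F m i) x].
have cDD : countable DD.
  apply: bigcup_countable => // m _; apply: bigcup_countable => // i _.
  exact: countable_qhulls.
have [|e [Ee Pe De]] := Gdelta_generic cX gE cDD _ oP EP.
  by move=> _ [m _ [i _ [_ [x _ ->]]]]; exact: closed_qhull.
exists e; split => // N oN Ne.
have [N0 [oN0 N0e noV]] := nzd e Ee.
have : nbhs e (N `&` N0) by apply: open_nbhs_nbhs; split; [exact: openI|].
rewrite -nbhs_ballE => -[r /= r0 rN].
have r20 : 0 < r / 2 by exact: divr_gt0.
have [m /= mr] := filter_ex (near_infty_natSinv_lt (PosNum r20)).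
have [oU cU dU] := UP m; have [i Ue] := cU e.
have UN : closure (U m i) `<=` N `&` N0.
  move=> y yU; apply: rN.
  have [z [Uz yz]] := yU _ (nbhsx_ballx y _ r20).
  rewrite (splitr r); apply: (@ball_triangle _ _ z).
    rewrite ballEmdist /=; exact: lt_trans (dU _ _ _ Ue Uz) mr.
  exact: ball_sym.
have Ye : Y e by exact: subset_closure.
have Fe : F m i e by split => //; exact: subset_closure.
have KF := qhull_closed_sub (clF m i) Fe.
have [nd|dg] := pselect (nondegenerate_set (qhull (F m i) e)).
  have [|B [oB Be YB]] := De (qhull (F m i) e) _ (@qhull_self _ _ e).
    by exists m => //; exists i => //; split => //; exists e.
  exists (qhull (F m i) e), B; split => //.
  - exact: closed_qhull.
  - exact: connected_qhull.
  - by move=> y /KF[Yy /UN[]].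
exfalso; apply: noV.
have KU : qhull (F m i) e `<=` U m i.
  move=> y Ky; suff <- : e = y by [].
  apply: contrapT => ey; apply: dg; exists e, y; split => //.
  exact: qhull_self.
have [V [FV Ve VU]] := qhull_open cX Fe (oU i) KU.
have VF := relclopen_sub FV.
have EF y : E y -> U m i y -> F m i y.
  by move=> Ey Uy; split; exact: subset_closure.
exists (E `&` V); split => //; last by move=> y [_ /VF[_ /UN[]]].
split.
  exists (U m i `&` ~` closure (F m i `\` V)).
    by apply: openI => //; apply: closed_openC; exact: closed_closure.
  apply/seteqP; split => y.
    move=> [Ey Vy]; split => //; split; first by apply/VU/subset_closure.
    exact: relclopen_closureD FV Vy.
  move=> [Ey [Uy nVy]]; split => //; apply: contrapT => nV.
  by apply: nVy; apply: subset_closure; split => //; exact: EF.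
exists (closure V); first exact: closed_closure.
apply/seteqP; split => y [Ey Vy]; split => //; first exact: subset_closure.
by apply: (relclopen_closure FV) => //; apply: EF => //; exact: VU.
Qed.

(** * Conclusion *)

Lemma zero_dimensional_at_relclopen (T : topologicalType) (E : set T) (e : set_type E) :
    (forall N, open N -> N (set_val e) ->
      exists V, [/\ relclopen E V, V (set_val e) & V `<=` N]) ->
  zero_dimensional_at e.
Proof.
move=> H N; rewrite {1}nbhsE => -[N' [[M oM <-] Me] MN].
have [V [[[ O oO VO] [D cD VD]] Ve VM]] := H M oM Me.
have Eval (x : set_type E) : E (set_val x) by exact: set_valP.
have oV : open (set_val @^-1` V : set (set_type E)).
  exists O => //; apply/seteqP; split => x /=; first by rewrite VO.
  by rewrite VO => -[].
exists (set_val @^-1` V); split.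
- split => //; rewrite -[X in closed X]setCK; apply: open_closedC.
  exists (~` D); first exact: closed_openC.
  apply/seteqP; split => x /=.
    by move=> nD; rewrite VD => -[].
  by rewrite VD => nV Dx; apply: nV.
- exact: open_nbhs_nbhs.
- by apply: subset_trans MN => x /= /VM.
Qed.

Theorem theorem1 (R : realType) (X : metricType R) (E : set X)
    (cX : continuum [set: X]) (sX : Suslinian X) (chX : chainable X)
    (E0 : E !=set0) (tdE : totally_disconnected E) (gE : Gdelta E) :
  exists e : set_type E, zero_dimensional_at e.
Proof.
have {cX} [cX _] := cX.
apply: contrapT => nozd.
have nzd e : E e -> exists N, [/\ open N, N e &
    ~ exists V, [/\ relclopen E V, V e & V `<=` N]].
  move=> Ee; apply: contrapT => H; apply: nozd.
  exists (SigSub (mem_set Ee)).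
  apply: zero_dimensional_at_relclopen => N oN Ne.
  by apply: contrapT => noV; apply: H; exists N.
have gen := generic_conn_im_kleinen cX sX chX gE nzd.
have [le cole] : exists le, @chain_order X le by exact: chainable_order chX.
have [|e [Ee _ cike]] := gen _ openT.
  by have [x Ex] := E0; exists x; split => //; exact: subset_closure.
have [C [P [clC cC CY [oP Pe YPC]]]] := cike _ openT I.
have CYs : C `<=` closure E by move=> y /CY[].
have Ce : C e by apply: YPC; split => //; exact: subset_closure.
have [N [oN Ne noV]] := nzd e Ee.
apply: noV; apply: (relclopen_at_conn_im_kleinen cX cole tdE clC cC Ee Ce _ oN Ne oP Pe).
- exact: conn_im_kleinen_sub CYs oP Pe YPC cike.
- by move=> y [Ey Py]; apply: YPC; split => //; exact: subset_closure.
- move=> Q oQ QP [y [Cy Qy]].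
  have [|b [Eb Qb cikb]] := gen _ oQ; first by exists y; split => //; exact: CYs.
  exists b; split => //.
    by apply: YPC; split; [exact: subset_closure|exact: QP].
  by apply: conn_im_kleinen_sub CYs oP (QP _ Qb) YPC cikb.
Qed.
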